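(* Let $n\geq 1$ and let $A\subseteq\{0,1\}^n$ be a nonempty monotone set. Then $$\phi(A)\;\geq\;\frac{\mathbb{P}[A]}{16\,n},$$ where $\mathbb{P}$ is the uniform probability measure on $\{0,1\}^n$ and $\phi(A)$ is the conductance of $A$, viewed as the subgraph of the hypercube induced by $A$ with self-loops added so that every vertex has degree $n$.
   Context: Partial order: for $x,y\in\{0,1\}^n$, $x\leq y$ means $x_i\leq y_i$ for all $i\in\{1,\dots,n\}$. A set $A\subseteq\{0,1\}^n$ is monotone if $x\in A$ and $x\leq y$ imply $y\in A$. $\mathbb{P}$ denotes the uniform probability measure on $\{0,1\}^n$, so $\mathbb{P}[A]=|A|/2^n$. Graph structure on $A$: the vertex set is $A$; two distinct vertices $x,y\in A$ are adjacent if and only if they differ in exactly one coordinate; to each vertex one adds self-loops, each contributing $1$ to the degree, so that every vertex of $A$ has degree exactly $n$. Conductance: for a nonempty $S\subseteq A$, let $\mathrm{vol}(S)$ be the sum of the degrees of the vertices in $S$ (so here $\mathrm{vol}(S)=n|S|$), let $\partial_E S$ be the set of edges $(x,y)$ of the graph with $x\in S$ and $y\in A\setminus S$, and let $\Phi(S)=|\partial_E S|/\mathrm{vol}(S)$. Then $$\phi(A)=\min\{\Phi(S): \emptyset\neq S\subseteq A,\ \mathrm{vol}(S)\leq \tfrac12\mathrm{vol}(A)\},$$ where the volume condition is equivalent to $|S|\leq |A|/2$. If there is no such $S$ (that is, $|A|=1$), the minimum is by convention $+\infty$. *)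

(* Defs.v *)
From HB Require Import structures.
From mathcomp Require Import all_boot all_order all_algebra.
From mathcomp Require Import constructive_ereal.

Set Implicit Arguments.
Unset Strict Implicit.
Unset Printing Implicit Defensive.

Import Order.TTheory GRing.Theory Num.Theory.
Local Open Scope ring_scope.

Definition cube (n : nat) : finType := {ffun 'I_n -> bool}.

Definition cube_le (n : nat) (x y : cube n) : Prop :=
  forall i : 'I_n, (x i <= y i)%N.

Definition monotone_set (n : nat) (A : {set cube n}) : Prop :=
  forall x y : cube n, x \in A -> cube_le x y -> y \in A.

Definition cube_prob (n : nat) (A : {set cube n}) : rat :=
  #|A|%:R / (2 ^ n)%:R.

Definition cube_adj (n : nat) (x y : cube n) : bool :=
  #|[set i : 'I_n | x i != y i]| == 1%N.

Section InducedGraph.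

Variables (n : nat) (A : {set cube n}).

Definition nbrs (x : cube n) : {set cube n} := [set y in A | cube_adj x y].

(* The subtraction never truncates, see [degE]. *)
Definition loops (x : cube n) : nat := (n - #|nbrs x|)%N.

Definition deg (x : cube n) : nat := (#|nbrs x| + loops x)%N.

Definition vol (S : {set cube n}) : nat := (\sum_(x in S) deg x)%N.

(* Each boundary edge occurs once, oriented from [S] to its complement in
   [A]. *)
Definition edge_boundary (S : {set cube n}) : {set cube n * cube n} :=
  [set e | [&& e.1 \in S, e.2 \in A :\: S & cube_adj e.1 e.2]].

Definition set_conductance (S : {set cube n}) : rat :=
  #|edge_boundary S|%:R / (vol S)%:R.

(* Extended rationals, so that the minimum over the empty family is [+oo]. *)
Definition conductance : \bar rat :=
  \big[Order.min/+oo%E]_(S : {set cube n} |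
      [&& S != set0, S \subset A & (vol S)%:R <= 2^-1 * (vol A)%:R :> rat])
    (set_conductance S)%:E.

Lemma card_nbrs_le (x : cube n) : (#|nbrs x| <= n)%N.
Proof.
pose flip (i : 'I_n) : cube n := [ffun j => x j (+) (j == i)].
rewrite -[leqRHS]card_ord -cardsT.
apply: leq_trans (leq_imset_card flip _).
apply/subset_leq_card/subsetP => y; rewrite inE => /andP[_ /cards1P[i xyi]].
apply/imsetP; exists i => //; apply/ffunP => j; rewrite ffunE.
have := in_set1 j i; rewrite -xyi inE => <-.
by case: (x j); case: (y j).
Qed.

Lemma degE (x : cube n) : deg x = n.
Proof. by rewrite /deg /loops subnKC ?card_nbrs_le. Qed.

End InducedGraph.

(* Main.v *)
(** For disjoint [S] and [T] covering a monotone set [A], an upward edge leaving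
    [S] or [T] stays in [A], hence is a boundary edge of [S].  It thus suffices
    to bound below the number of upward edges leaving [S] plus those leaving [T].
    For arbitrary [S] and [T] one has the following robust Harris inequality:
      [|S| |T| / 2^n <= |S :&: T| + up_exits S + up_exits T],
    proved by induction on [n], splitting the cube along one coordinate. *)
Require Import Defs.
From mathcomp Require Import all_boot all_order all_algebra.
From mathcomp Require Import constructive_ereal.
From mathcomp Require Import zify ring lra.

Local Open Scope ring_scope.

Import Order.TTheory GRing.Theory Num.Theory.

Definition raise {n : nat} (i : 'I_n) (x : cube n) : cube n :=
  [ffun j => (j == i) || x j].

Definition cube_cons {n : nat} (b : bool) (x : cube n) : cube n.+1 :=
  [ffun i => if unlift ord0 i is Some j then x j else b].

(** Counts the upward cube edges leaving [S]: where [x i] is already true, [raise i x] is [x] and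
    the term vanishes. *)
Definition up_exits {n : nat} (S : {set cube n}) : nat :=
  (\sum_(x : cube n) \sum_(i < n) ((x \in S) && (raise i x \notin S)))%N.

Definition cube_section {n : nat} (S : {set cube n.+1}) (b : bool) :
  {set cube n} := [set x | cube_cons b x \in S].

Lemma raise_cons0 {n : nat} (b : bool) (x : cube n) :
  raise ord0 (cube_cons b x) = cube_cons true x.
Proof.
apply/ffunP => i; rewrite !ffunE; case: unliftP => [j ->|->]; last by rewrite eqxx.
by rewrite eq_sym (negPf (neq_lift _ _)).
Qed.

Lemma raise_cons_lift {n : nat} (b : bool) (i : 'I_n) (x : cube n) :
  raise (lift ord0 i) (cube_cons b x) = cube_cons b (raise i x).
Proof.
apply/ffunP => j; rewrite !ffunE; case: unliftP => [k ->|->].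
  by rewrite ffunE (inj_eq lift_inj).
by rewrite (negPf (neq_lift _ _)).
Qed.

Lemma sum_cube_cons {n : nat} (F : cube n.+1 -> nat) :
  (\sum_x F x = \sum_x F (cube_cons false x) + \sum_x F (cube_cons true x))%N.
Proof.
pose h (p : bool * cube n) : cube n.+1 := cube_cons p.1 p.2.
pose k (x : cube n.+1) : bool * cube n := (x ord0, [ffun i => x (lift ord0 i)]).
have hK : cancel h k.
  move=> [b x]; rewrite /h /k; congr pair; first by rewrite ffunE unlift_none.
  by apply/ffunP => i; rewrite !ffunE liftK.
have kK : cancel k h.
  move=> x; apply/ffunP => i; rewrite !ffunE.
  by case: unliftP => [j ->|->]; rewrite ?ffunE.
rewrite (reindex h) /=; last by exists k => x _; [apply: hK | apply: kK].
rewrite -(pair_bigA _ (fun b x => F (cube_cons b x))) /=.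
by rewrite big_bool addnC.
Qed.

Lemma card_cube_sections {n : nat} (S : {set cube n.+1}) :
  #|S| = (#|cube_section S false| + #|cube_section S true|)%N.
Proof.
rewrite -!sum1_card big_mkcond sum_cube_cons /= -!big_mkcond.
by congr addn; apply: eq_bigl => x; rewrite inE.
Qed.

(** Edges in a direction other than [ord0] stay within one section; an edge in direction [ord0] goes
    from the false section to the true one, and leaves [S] exactly over the set difference. *)
Lemma up_exits_sections {n : nat} (S : {set cube n.+1}) :
  up_exits S = (up_exits (cube_section S false) + up_exits (cube_section S true)
                + #|cube_section S false :\: cube_section S true|)%N.
Proof.
have split_first b x :
    (\sum_(i < n.+1) ((cube_cons b x \in S) && (raise i (cube_cons b x) \notin S))
     = ((cube_cons b x \in S) && (cube_cons true x \notin S))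
       + \sum_(i < n) ((x \in cube_section S b)
                       && (raise i x \notin cube_section S b)))%N.
  rewrite big_ord_recl raise_cons0; congr addn.
  by apply: eq_bigr => i _; rewrite raise_cons_lift !inE.
rewrite /up_exits sum_cube_cons.
under eq_bigr => x _ do rewrite split_first.
under [X in (_ + X = _)%N]eq_bigr => x _ do rewrite split_first.
(* Raising [ord0] fixes the points of the true section, so they give no exit in that direction. *)
rewrite !big_split /= [X in (_ + (X + _))%N]big1; last by move=> x _; rewrite andbN.
rewrite add0n [RHS]addnC addnA; congr (_ + _ + _)%N.
rewrite -sum1_card [RHS]big_mkcond /=; apply: eq_bigr => x _.
by rewrite !inE andbC; case: (_ && _).
Qed.

Lemma card_cube_set_le {n : nat} (S : {set cube n}) : (#|S| <= 2 ^ n)%N.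
Proof. by rewrite (leq_trans (max_card _)) // card_ffun card_bool card_ord. Qed.

Lemma robust_harris {n : nat} (S T : {set cube n}) :
  (#|S| * #|T| <= 2 ^ n * (#|S :&: T| + up_exits S + up_exits T))%N.
Proof.
elim: n S T => [|n IHn] S T.
  (* The cube of dimension 0 is a single point, so two nonempty subsets of it meet. *)
  have pt (x y : cube 0) : x = y by apply/ffunP; case.
  have [->|[x xS]] := set_0Vmem S; first by rewrite cards0.
  have [->|[y yT]] := set_0Vmem T; first by rewrite cards0 muln0.
  have : (0 < #|S :&: T|)%N.
    by apply/card_gt0P; exists x; rewrite inE xS (pt x y).
  by move: (card_cube_set_le S) (card_cube_set_le T); rewrite expn0; nia.
have secI b :
    cube_section (S :&: T) b = cube_section S b :&: cube_section T b.
  by apply/setP => x; rewrite !inE.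
rewrite (card_cube_sections (S :&: T)) !secI !up_exits_sections.
rewrite (card_cube_sections S) (card_cube_sections T) expnS.
have drop (B C : {set cube n}) : (#|B| <= #|C| + #|B :\: C|)%N.
  by rewrite -(cardsID C B) leq_add2r subset_leq_card ?subsetIr.
move: (IHn (cube_section S false) (cube_section T false)).
move: (IHn (cube_section S true) (cube_section T true)).
move: (drop (cube_section S false) (cube_section S true)).
move: (drop (cube_section T false) (cube_section T true)).
move: (card_cube_set_le (cube_section S false)) (card_cube_set_le (cube_section S true)).
move: (card_cube_set_le (cube_section T false)) (card_cube_set_le (cube_section T true)).
set s0 := #|cube_section S false|; set s1 := #|cube_section S true|.
set t0 := #|cube_section T false|; set t1 := #|cube_section T true|.
set dS := #|cube_section S false :\: _|; set dT := #|cube_section T false :\: _|.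
move: (2 ^ n)%N (up_exits _) (up_exits _) (up_exits _) (up_exits _) => N u1 u2 u3 u4.
move: #|_ :&: _| #|_ :&: _| => i0 i1.
move: s0 s1 t0 t1 dS dT => s0 s1 t0 t1 dS dT t0N t1N s0N s1N leT leS IH1 IH0.
(* Twice the sum of the two induction hypotheses differs from the goal by
   [(s1 - s0) * (t1 - t0)], which is negative only if one of [S], [T] loses
   points when going up; [dS] and [dT] pay for that. *)
have cross : (s0 * t1 + s1 * t0 <= s0 * t0 + s1 * t1 + N * (dS + dT))%N.
  have [s01|s10] := leqP s0 s1; have [t01|t10] := leqP t0 t1.
  - by move: s01 t01 => /subnKC <- /subnKC <-; nia.
  (* Opposite trends: the gain [s1 - s0] is at most the section size bound [N], and the loss
     [t0 - t1] is at most [dT]. *)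
  - have : ((s1 - s0) * (t0 - t1) <= N * dT)%N by apply: leq_mul; lia.
    by nia.
  - have : ((s0 - s1) * (t1 - t0) <= dS * N)%N by apply: leq_mul; lia.
    by nia.
  - by move: s10 t10 => /ltnW/subnKC <- /ltnW/subnKC <-; nia.
by nia.
Qed.

Lemma cube_le_raise {n : nat} (i : 'I_n) (x : cube n) : cube_le x (raise i x).
Proof. by move=> j; rewrite ffunE; case: (x j); rewrite ?orbT. Qed.

Lemma cube_le_anti {n : nat} (x y : cube n) : cube_le x y -> cube_le y x -> x = y.
Proof.
move=> xy yx; apply/ffunP => i; move: (xy i) (yx i).
by case: (x i); case: (y i).
Qed.

Lemma raise_neq {n : nat} (i : 'I_n) (x : cube n) :
  raise i x != x -> [set j | x j != raise i x j] = [set i].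
Proof.
move=> xi; have xi0 : x i = false.
  apply: contra_neqF xi => xi1; apply/ffunP => j; rewrite ffunE.
  by have [->|] := eqVneq j i; rewrite ?xi1.
apply/setP => j; rewrite !inE ffunE; have [->|ji] /= := eqVneq j i.
  by rewrite xi0.
by rewrite eqxx.
Qed.

Lemma cube_adj_sym {n : nat} (x y : cube n) : cube_adj x y = cube_adj y x.
Proof. by congr (#|pred_of_set _| == 1%N); apply/setP => i; rewrite !inE eq_sym. Qed.

(** Monotonicity keeps the upper endpoint in [A], so each exit from [S] or from [A :\: S] crosses
    between the two. Distinct exits give distinct boundary edges. *)
Lemma up_exits_le_boundary {n : nat} (A S : {set cube n}) :
  monotone_set A -> S \subset A ->
  (up_exits S + up_exits (A :\: S) <= #|edge_boundary A S|)%N.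
Proof.
move=> A_mono /subsetP SA.
pose P := [set p : cube n * 'I_n |
  (p.1 \in A) && ((p.1 \in S) != (raise p.2 p.1 \in S))].
(* Boundary edges are listed with their endpoint in [S] first, so an exit from [A :\: S] is
   reversed. *)
pose f (p : cube n * 'I_n) :=
  if p.1 \in S then (p.1, raise p.2 p.1) else (raise p.2 p.1, p.1).
have -> : (up_exits S + up_exits (A :\: S))%N = #|P|.
  rewrite -sum1_card big_mkcond.
  under eq_bigr => p _ do rewrite inE.
  rewrite -(pair_bigA _ (fun x i =>
    if (x \in A) && ((x \in S) != (raise i x \in S)) then 1%N else 0%N)) /=.
  rewrite -big_split; apply: eq_bigr => x _ /=; rewrite -big_split.
  apply: eq_bigr => i _ /=; rewrite !inE.
  have [xA|xA] := boolP (x \in A); last first.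
    by rewrite (contraNF (SA x) xA) andbF.
  rewrite (A_mono _ _ xA (cube_le_raise i x)).
  by case: (x \in S); case: (raise i x \in S).
have moves p : p \in P -> raise p.2 p.1 != p.1.
  by rewrite inE => /andP[_]; apply: contra_neq => ->.
have f_inj : {in P &, injective f}.
  (* Two exits giving the same pair through different branches of [f] would have each point below
     the other, against [moves]. *)
  have asym (x y : cube n) (i j : 'I_n) : x = raise j y -> raise i x = y -> raise i x = x.
    move=> xy yx; apply: cube_le_anti; last exact: cube_le_raise.
    by rewrite yx xy; apply: cube_le_raise.
  (* The direction is recovered as the only coordinate where the endpoints differ. *)
  have same (x : cube n) (i j : 'I_n) : raise i x != x -> raise i x = raise j x -> i = j.
    move=> xi ij; apply/set1P; rewrite -(raise_neq j x) -ij //.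
    by rewrite raise_neq // set11.
  move=> [x i] [y j] /moves /= xi /moves /= yj; rewrite /f /=.
  case: ifP => _; case: ifP => _ [].
  - by move=> xy ij; subst y; rewrite (same x i j).
  - by move=> xy yx; rewrite (asym x y i j) ?eqxx in xi.
  - by move=> yx xy; rewrite (asym x y i j) ?eqxx in xi.
  - by move=> ij xy; subst y; rewrite (same x i j).
rewrite -(card_in_imset f_inj); apply/subset_leq_card/subsetP => e /imsetP[p pP ->].
have adj : cube_adj p.1 (raise p.2 p.1).
  by rewrite /cube_adj raise_neq ?moves // cards1.
move: pP; rewrite !inE /f => /andP[pA].
have rA := A_mono _ _ pA (cube_le_raise p.2 p.1).
case: ifP => [pS|pS] /=; first by rewrite pS rA adj; case: (_ \in S).
by rewrite pS pA cube_adj_sym adj; case: (_ \in S).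
Qed.

Lemma volE {n : nat} (A S : {set cube n}) : vol A S = (n * #|S|)%N.
Proof.
rewrite /vol; under eq_bigr => x _ do rewrite degE.
by rewrite sum_nat_const mulnC.
Qed.

Theorem theorem1p1 (n : nat) (A : {set cube n})
    (n_ge1 : (1 <= n)%N) (A_neq0 : A != set0) (A_mono : monotone_set A) :
  ((cube_prob A / (16 * n%:R))%:E <= conductance A)%E.
Proof.
rewrite /conductance; elim/big_ind: _ => [|a b ha hb|S /and3P[S0 SA]].
- exact: leey.
- by rewrite le_min ha hb.
rewrite lee_fin /cube_prob /set_conductance !volE => vol_le.
have cardS : (2 * #|S| <= #|A|)%N.
  have : (n * (2 * #|S|) <= n * #|A|)%N.
    by rewrite -(ler_nat rat); move: vol_le; rewrite !natrM; lra.
  by rewrite leq_pmul2l.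
have S_gt0 : (0 < #|S|)%N by rewrite card_gt0.
(* Here [T] is [A :\: S], disjoint from [S], so only exits remain in [robust_harris]. The factor 2
   comes from [A :\: S] holding at least half of [A]. *)
have bound : (#|A| * #|S| <= 2 * 2 ^ n * #|edge_boundary A S|)%N.
  have := robust_harris S (A :\: S).
  rewrite [S :&: _]setIDA setDIl setDv set0I cards0 add0n.
  have := up_exits_le_boundary A S A_mono SA.
  have := cardsD A S; rewrite (setIidPr SA).
  set N := (2 ^ n)%N; set d := #|edge_boundary A S|; set u := (_ + _)%N.
  move=> cardT ud harris.
  have leNd : (N * u <= N * d)%N by rewrite leq_mul2l ud orbT.
  have : (#|A| * #|S| <= 2 * #|A :\: S| * #|S|)%N by apply: leq_mul; lia.
  by lia.
rewrite -mulrA -invfM -2!natrM.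
rewrite ler_pdivrMr ?ltr0n ?muln_gt0 ?expn_gt0 ?n_ge1 //.
rewrite mulrAC ler_pdivlMr ?ltr0n ?muln_gt0 ?n_ge1 //.
rewrite -2!natrM ler_nat.
(* The [n] from the volume of [S] cancels the [n] of the claimed bound; what is left is [bound],
   with 2 relaxed to 16. *)
rewrite mulnCA [leqRHS](_ : _ = n * (16 * 2 ^ n * #|edge_boundary A S|))%N; last by ring.
by rewrite leq_mul2l (leq_trans bound) ?orbT // !leq_mul2r /= !orbT.
Qed.
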